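(* Let $f:\mathbb{R}^n\to\mathbb{R}$ be twice continuously differentiable with $L$-Lipschitz gradient, and let $x^*$ be a strict saddle point of $f$. If $\{x_k\}_{k\ge 0}$ is generated by the BCGD method with constant step size $0<\alpha<\frac{1}{L}$ from an initial point $x_0$ distributed according to $\nu$, then $$\mathbb{P}_\nu\left[\lim_{k\to\infty} x_k = x^*\right]=0.$$
   Context: $f$ has Lipschitz continuous gradient with constant $L>0$: $\|\nabla f(x)-\nabla f(y)\|\le L\|x-y\|$ for all $x,y$. The variable is partitioned into $p$ blocks $x=(x(1),\dots,x(p))$ with $x(s)\in\mathbb{R}^{n_s}$, $\sum_s n_s=n$. Let $U_s\in\mathbb{R}^{n\times n_s}$ be the $s$-th block-column of $I_n$, so $(U_1,\dots,U_p)=I_n$, $x(s)=U_s^Tx$ and $\nabla_s f(x)=U_s^T\nabla f(x)$. BCGD method: given $x_k$, set $x_k^0=x_k$, $x_k^s=x_k^{s-1}-\alpha U_s\nabla_s f(x_k^{s-1})$ for $s=1,\dots,p$, and $x_{k+1}=x_k^p$. A point $x^*$ is a critical point if $\nabla f(x^* )=0$; it is a strict saddle if it is a critical point and $\lambda_{\min}(\nabla^2 f(x^* ))<0$. $\nu$ is a probability measure on $\mathbb{R}^n$ absolutely continuous with respect to Lebesgue measure, and $\mathbb{P}_\nu$ denotes probability with respect to it. *)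

(* Defs.v *)
From HB Require Import structures.
From mathcomp Require Import all_boot all_order all_algebra.
From mathcomp Require Import all_classical all_reals all_analysis.
Import Order.TTheory GRing.Theory Num.Theory.
Import numFieldNormedType.Exports.

Set Implicit Arguments.
Unset Strict Implicit.
Unset Printing Implicit Defensive.

Local Open Scope classical_set_scope.
Local Open Scope ring_scope.

Section BCGD.
Variables (R : realType) (n : nat).
Local Notation vec := 'rV[R]_n.

Definition enorm (x : vec) : R := Num.sqrt (\sum_(i < n) x ord0 i ^+ 2).

Definition basis_vec (i : 'I_n) : vec := delta_mx 0 i.
Definition partial (f : vec -> R) (i : 'I_n) (x : vec) : R :=
  'D_(basis_vec i) f x.

Definition grad (f : vec -> R) (x : vec) : vec := \row_i partial f i x.
Definition hessian (f : vec -> R) (x : vec) : 'M[R]_n :=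
  \matrix_(i, j) partial (partial f i) j x.

Definition C2 (f : vec -> R) : Prop :=
  (forall x, differentiable f x) /\
  (forall i x, differentiable (partial f i) x) /\
  (forall i j, continuous (partial (partial f i) j)).

Definition grad_lipschitz (f : vec -> R) (L : R) : Prop :=
  forall x y, enorm (grad f x - grad f y) <= L * enorm (x - y).

Definition critical_point (f : vec -> R) (x : vec) : Prop := grad f x = 0.

(* strict saddle: critical point with lambda_min(Hessian) < 0, i.e. the
   (symmetric) Hessian has a negative eigenvalue *)
Definition strict_saddle (f : vec -> R) (x : vec) : Prop :=
  critical_point f x /\ exists a : R, eigenvalue (hessian f x) a /\ a < 0.

(* Block partition: p consecutive blocks of sizes ns s, sum = n.
   Coordinate i belongs to block s iff
   ns 0 + ... + ns (s-1) <= i < ns 0 + ... + ns s. *)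
Variables (p : nat) (ns : 'I_p -> nat).

Definition in_block (s : 'I_p) (i : 'I_n) : bool :=
  ((\sum_(t < p | (t < s)%N) ns t)%N <= i)%N &&
  (i < (\sum_(t < p | (t <= s)%N) ns t)%N)%N.

(* U_s grad_s f(x) = U_s U_s^T grad f(x): gradient with coordinates outside
   block s set to zero *)
Definition block_grad (f : vec -> R) (s : 'I_p) (x : vec) : vec :=
  \row_i (if in_block s i then partial f i x else 0).

Definition block_step (f : vec -> R) (alpha : R) (s : 'I_p) (x : vec) : vec :=
  x - alpha *: block_grad f s x.

Definition bcgd_step (f : vec -> R) (alpha : R) (x : vec) : vec :=
  foldl (fun y s => block_step f alpha s y) x (enum 'I_p).

Definition bcgd_seq (f : vec -> R) (alpha : R) (x0 : vec) (k : nat) : vec :=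
  iter k (bcgd_step f alpha) x0.

End BCGD.

Section Leb.
Variables (R : realType) (n : nat).
Local Notation vec := 'rV[R]_n.

Definition box (a b : vec) : set vec :=
  [set x | forall i, a ord0 i <= x ord0 i <= b ord0 i].
Definition box_vol (a b : vec) : R := \prod_(i < n) (b ord0 i - a ord0 i).

Definition lebesgue_null (A : set vec) : Prop :=
  forall eps : R, 0 < eps -> exists a b : nat -> vec,
    (forall k i, a k ord0 i <= b k ord0 i) /\
    A `<=` \bigcup_k box (a k) (b k) /\
    (\sum_(0 <= k <oo) (box_vol (a k) (b k))%:E <= eps%:E)%E.

Definition borel_rV : Type := g_sigma_algebraType (@open vec).

End Leb.

Definition leb_abs_cont (R : realType) (n : nat)
  (nu : probability (borel_rV R n) R) : Prop :=
  forall A : set (borel_rV R n), measurable A -> lebesgue_null A -> nu A = 0%E.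

(* Main.v *)
Require Import Defs.
From HB Require Import structures.
From mathcomp Require Import all_boot all_order all_algebra.
From mathcomp Require Import all_classical all_reals all_analysis.
From mathcomp Require Import ring lra.
Import Order.TTheory GRing.Theory Num.Theory.
Import numFieldNormedType.Exports.

Set Implicit Arguments.
Unset Strict Implicit.
Unset Printing Implicit Defensive.

Local Open Scope classical_set_scope.
Local Open Scope ring_scope.

(* Write T for one sweep of the method, H for the Hessian at the saddle x* and A
   for the derivative of T at x*, that is, one sweep on the quadratic form
   q(z) = <z, zH>.  A sweep decreases q by c D^2, where D is the length of the
   path of its block steps; D also controls |zH|, and |q(z)| <= K |zH|^2 because
   H is symmetric.  Hence for small delta the form Q(z) = - q(z) - delta |z|^2
   grows strictly under A on the cone Q >= 0, and so it does for differences of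
   points close to x* under the nonlinear map T.  Two orbits staying near x* are
   therefore never separated by a vector of this cone.  The cone contains a
   neighbourhood of an eigenvector of H with negative eigenvalue, so the set of
   points whose whole orbit stays near x* is a Lipschitz graph over a hyperplane.
   As alpha L < 1, T expands distances at least by a constant factor c > 0, so the
   preimage of this graph under T^N can be covered by O(M^(n-1)) cubes of side
   O(1/M).  The orbits converging to x* start in the union of these preimages. *)

(** * Euclidean inner product and norm on row vectors *)

Section Euclidean.
Variables (R : realType) (n : nat).
Implicit Types (x y z : 'rV[R]_n) (a : R).

Definition dot x y : R := \sum_(i < n) x ord0 i * y ord0 i.

Lemma dotC x y : dot x y = dot y x.
Proof. by apply: eq_bigr => i _; rewrite mulrC. Qed.

Lemma dotDl x y z : dot (x + y) z = dot x z + dot y z.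
Proof. by rewrite /dot -big_split /=; apply: eq_bigr => i _; rewrite mxE mulrDl. Qed.

Lemma dotZl a x y : dot (a *: x) y = a * dot x y.
Proof. by rewrite /dot big_distrr /=; apply: eq_bigr => i _; rewrite mxE mulrA. Qed.

Lemma dotDr x y z : dot x (y + z) = dot x y + dot x z.
Proof. by rewrite dotC dotDl !(dotC _ x). Qed.

Lemma dotZr a x y : dot x (a *: y) = a * dot x y.
Proof. by rewrite dotC dotZl dotC. Qed.

Lemma dotNl x y : dot (- x) y = - dot x y.
Proof. by rewrite -scaleN1r dotZl mulN1r. Qed.

Lemma dotNr x y : dot x (- y) = - dot x y.
Proof. by rewrite dotC dotNl dotC. Qed.

Lemma dot_mulmx (A : 'M[R]_n) x y : dot (x *m A) y = dot x (y *m A^T).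
Proof.
have dotE u v : dot u v = (u *m v^T) ord0 ord0.
  by rewrite mxE; apply: eq_bigr => i _; rewrite mxE.
by rewrite !dotE trmx_mul trmxK mulmxA.
Qed.

Lemma dotxx_ge0 x : 0 <= dot x x.
Proof. by apply: sumr_ge0 => i _; rewrite -expr2 sqr_ge0. Qed.

Lemma enormE x : enorm x = Num.sqrt (dot x x).
Proof. by congr Num.sqrt; apply: eq_bigr => i _; rewrite expr2. Qed.

Lemma enorm_ge0 x : 0 <= enorm x.
Proof. by rewrite enormE sqrtr_ge0. Qed.

Lemma enorm_sqr x : enorm x ^+ 2 = dot x x.
Proof. by rewrite enormE sqr_sqrtr ?dotxx_ge0. Qed.

Lemma coord_le_enorm x i : `|x ord0 i| <= enorm x.
Proof.
rewrite -sqrtr_sqr; apply: ler_wsqrtr.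
by rewrite (bigD1 i) //= lerDl; apply: sumr_ge0 => j _; rewrite sqr_ge0.
Qed.

Lemma enorm0_eq0 x : enorm x = 0 -> x = 0.
Proof.
move=> x0; apply/rowP => i; rewrite mxE; apply/eqP; rewrite -normr_le0 -x0.
exact: coord_le_enorm.
Qed.

Lemma enorm0 : enorm (0 : 'rV[R]_n) = 0.
Proof. by rewrite enormE -(scale0r 0) dotZl mul0r sqrtr0. Qed.

Lemma enormZ a x : enorm (a *: x) = `|a| * enorm x.
Proof.
by rewrite !enormE dotZl dotZr mulrA -expr2 sqrtrM ?sqr_ge0// sqrtr_sqr.
Qed.

Lemma enormN x : enorm (- x) = enorm x.
Proof. by rewrite -scaleN1r enormZ normrN1 mul1r. Qed.

Lemma enorm_distC x y : enorm (x - y) = enorm (y - x).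
Proof. by rewrite -enormN opprB. Qed.

(** Cauchy-Schwarz, from expanding the squared length of [|y|^2 x - <x,y> y]. *)
Lemma dot_le_enorm x y : `|dot x y| <= enorm x * enorm y.
Proof.
have [y0|yn0] := eqVneq (enorm y) 0.
  have -> : y = 0 by exact: enorm0_eq0.
  by rewrite -(scale0r 0) dotZr mul0r normr0 mulr_ge0 ?enorm_ge0.
have y_gt0 : 0 < enorm y by rewrite lt_def yn0 enorm_ge0.
have: 0 <= dot (enorm y ^+ 2 *: x - dot x y *: y) (enorm y ^+ 2 *: x - dot x y *: y).
  exact: dotxx_ge0.
rewrite !(dotDl, dotDr, dotNl, dotNr, dotZl, dotZr) (dotC y x) -!enorm_sqr.
set a := enorm x; set b := enorm y in yn0 y_gt0 *; set d := dot x y => h.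
have h2 : 0 <= b ^+ 2 * ((a * b) ^+ 2 - d ^+ 2) by lra.
have a0 : 0 <= a by exact: enorm_ge0.
rewrite -(ler_pXn2r (n:=2)) ?nnegrE ?mulr_ge0 ?(ltW y_gt0)//.
by rewrite real_normK ?num_real// -subr_ge0 -(pmulr_rge0 _ (exprn_gt0 2 y_gt0)).
Qed.

Lemma enormD_le x y : enorm (x + y) <= enorm x + enorm y.
Proof.
rewrite -(ler_pXn2r (n:=2)) ?nnegrE ?addr_ge0 ?enorm_ge0//.
rewrite enorm_sqr !(dotDl, dotDr) (dotC y x) -!enorm_sqr.
have := le_trans (ler_norm _) (dot_le_enorm x y); lra.
Qed.

Lemma enormB_le x y : enorm (x - y) <= enorm x + enorm y.
Proof. by rewrite -(enormN y) enormD_le. Qed.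

Lemma enorm_trans y x z : enorm (x - z) <= enorm (x - y) + enorm (y - z).
Proof. by rewrite -[x - z](subrKA y) addrC addrC enormD_le. Qed.

End Euclidean.

Lemma enorm_le_coord (R : realType) (n : nat) (x : 'rV[R]_n) (a : R) :
  (forall i, `|x ord0 i| <= a) -> enorm x <= n%:R * a.
Proof.
case: n x => [|m] x xa.
  by rewrite mul0r enormE /dot big_ord0 sqrtr0.
have a0 : 0 <= a by apply: le_trans (xa ord0).
rewrite -(ler_pXn2r (n:=2)) ?nnegrE ?mulr_ge0 ?enorm_ge0//.
rewrite enorm_sqr exprMn; apply: (@le_trans _ _ (\sum_(i < m.+1) a ^+ 2)).
  by apply: ler_sum => i _; rewrite -expr2 -real_normK ?num_real// lerXn2r ?nnegrE.
rewrite sumr_const card_ord -[_ *+ m.+1]mulr_natl ler_wpM2r ?sqr_ge0// expr2 -natrM ler_nat.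
by rewrite leq_pmulr.
Qed.

(** * Descent of a quadratic form under linear block steps *)

Section LinearDescent.
Variables (R : realType) (n : nat) (H : 'M[R]_n) (L alpha : R).
Hypothesis (L_ge0 : 0 <= L) (alpha_gt0 : 0 < alpha) (alphaL : alpha * L <= 1).
Hypothesis (H_sym : H^T = H) (H_le : forall z : 'rV[R]_n, enorm (z *m H) <= L * enorm z).
Implicit Types (z u : 'rV[R]_n) (b : pred 'I_n) (bs : seq (pred 'I_n)).

Definition block_mask b z : 'rV[R]_n := \row_i (if b i then z ord0 i else 0).

(** A block gradient step for half of [qform], whose gradient at [z] is [z *m H] for symmetric
    [H]. *)
Definition lin_step b z := z - alpha *: block_mask b (z *m H).

Definition lin_iter bs z := foldl (fun y b => lin_step b y) z bs.

Definition qform z : R := dot z (z *m H).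

Lemma dot_mask b z : dot (block_mask b z) z = dot (block_mask b z) (block_mask b z).
Proof.
by apply: eq_bigr => i _; rewrite !mxE; case: ifP => //; rewrite !mul0r.
Qed.

Lemma dot_mulmx_sym z u : dot z (u *m H) = dot u (z *m H).
Proof. by rewrite dotC dot_mulmx H_sym. Qed.

(** With [u] the masked gradient, the first-order term is [- 2 alpha |u|^2], and the second-order
    term [alpha^2 <u, uH>] is at most [alpha |u|^2] since [alpha * L <= 1]. *)
Lemma qform_lin_step b z :
  qform (lin_step b z) <= qform z - alpha * enorm (block_mask b (z *m H)) ^+ 2.
Proof.
rewrite /qform /lin_step; set u := block_mask b (z *m H).
have uz : dot u (z *m H) = enorm u ^+ 2 by rewrite enorm_sqr dot_mask.
have uu : dot u (u *m H) <= L * enorm u ^+ 2.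
  apply: le_trans (ler_norm _) _; apply: le_trans (dot_le_enorm _ _) _.
  have := H_le u; have := enorm_ge0 u; rewrite expr2; nra.
rewrite mulmxBl -scalemxAl !(dotDl, dotDr, dotNl, dotNr, dotZl, dotZr).
rewrite (dot_mulmx_sym z u) uz.
have := sqr_ge0 (enorm u); set N := enorm u ^+ 2 in uu *.
set M := dot u _ in uu *; move=> N0.
have : alpha * (alpha * M) <= alpha * N.
  apply: ler_wpM2l; first exact: ltW.
  apply: (@le_trans _ _ (alpha * (L * N))); first by rewrite ler_wpM2l // ltW.
  by rewrite mulrA -[leRHS]mul1r ler_wpM2r.
lra.
Qed.

(* [D] stands for the length of the path formed by the successive block steps. *)
Lemma lin_iter_descent bs : exists2 c : R, 0 < c & exists2 C : R, 0 <= C &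
  forall z, exists D : R, [/\ 0 <= D,
    qform (lin_iter bs z) <= qform z - c * D ^+ 2,
    enorm (lin_iter bs z - z) <= D &
    forall i, has (fun b => b i) bs -> `|(z *m H) ord0 i| <= C * D].
Proof.
elim: bs => [|b bs [c c0 [C C0 IH]]].
  exists 1; rewrite ?ltr01//; exists 0 => // z; exists 0; split => //=.
    by rewrite expr0n mulr0 subr0.
  by rewrite subrr enorm0.
have m0 : 0 < Num.min c alpha^-1 by rewrite lt_min c0 invr_gt0.
(* The path grows by [alpha * |u|]; the factor 1/2 comes from [(s + t)^2 <= 2 (s^2 + t^2)]. *)
exists (Num.min c alpha^-1 / 2); first by rewrite divr_gt0.
exists (C + L + alpha^-1); first by rewrite !addr_ge0// invr_ge0 ltW.
move=> z; have [D [D0 Dq Dn DH]] := IH (lin_step b z).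
set u := block_mask b (z *m H); set m := Num.min _ _ in m0 *.
have dz : lin_step b z - z = - (alpha *: u) by rewrite /lin_step addrC addKr.
have u0 := enorm_ge0 u.
have au0 : 0 <= alpha * enorm u by rewrite mulr_ge0// ltW.
exists (D + alpha * enorm u); split => /=.
- by rewrite addr_ge0.
- apply: le_trans Dq _.
  have := qform_lin_step b z; rewrite -/u.
  have mc : m * D ^+ 2 <= c * D ^+ 2 by rewrite ler_wpM2r ?sqr_ge0// ge_min lexx.
  have ma : m * (alpha * enorm u) ^+ 2 <= alpha * enorm u ^+ 2.
    apply: (@le_trans _ _ (alpha^-1 * (alpha * enorm u) ^+ 2)).
      by rewrite ler_wpM2r ?sqr_ge0// ge_min lexx orbT.
    by rewrite exprMn mulrA expr2 mulKf ?gt_eqF.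
  have : 0 <= m * (D - alpha * enorm u) ^+ 2 by rewrite mulr_ge0 ?sqr_ge0 ?ltW.
  lra.
- apply: le_trans (enorm_trans (lin_step b z) _ _) _.
  by rewrite dz enormN enormZ gtr0_norm// lerD.
- move=> i /orP[bi|hi].
    have : `|(z *m H) ord0 i| <= enorm u.
      by apply: le_trans (coord_le_enorm u i); rewrite [X in _ <= `|X|]mxE bi.
    move=> /le_trans; apply.
    apply: (@le_trans _ _ (alpha^-1 * (D + alpha * enorm u))).
      by rewrite mulrDr mulKf ?gt_eqF// lerDr mulr_ge0// invr_ge0 ltW.
    by rewrite ler_wpM2r ?addr_ge0// lerDr addr_ge0.
  (* The induction hypothesis bounds the gradient after the first step, which differs from the one
     at [z] by at most [L * (alpha * |u|)]. *)
  have -> : z *m H = lin_step b z *m H + (alpha *: u) *m H.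
    by rewrite -mulmxDl /lin_step subrK.
  rewrite mxE; apply: le_trans (ler_normD _ _) _.
  apply: (@le_trans _ _ (C * D + L * (alpha * enorm u))).
    apply: lerD; first exact: DH.
    apply: le_trans (coord_le_enorm _ _) _; apply: le_trans (H_le _) _.
    by rewrite enormZ gtr0_norm.
  have : 0 <= C * (alpha * enorm u) by rewrite mulr_ge0.
  have : 0 <= L * D by rewrite mulr_ge0.
  have : 0 <= alpha^-1 * (D + alpha * enorm u).
    by rewrite mulr_ge0 ?addr_ge0// invr_ge0 ltW.
  lra.
Qed.

Lemma mulmx_enorm_bounded (A : 'M[R]_n) :
  exists2 K : R, 0 < K & forall z, enorm (z *m A) <= K * enorm z.
Proof.
pose K0 : R := \sum_i \sum_j `|A i j|.
have K00 : 0 <= K0 by apply: sumr_ge0 => i _; apply: sumr_ge0.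
exists (n%:R * K0 + 1); first by rewrite ltr_wpDl ?mulr_ge0.
move=> z; apply: (@le_trans _ _ (n%:R * (K0 * enorm z))).
  apply: enorm_le_coord => j; rewrite mxE; apply: le_trans (ler_norm_sum _ _ _) _.
  rewrite mulr_suml; apply: ler_sum => i _.
  rewrite normrM mulrC ler_pM ?coord_le_enorm//.
  by rewrite (bigD1 j)//= lerDl sumr_ge0.
by rewrite mulrDl mulrA lerDl mul1r enorm_ge0.
Qed.

(* Inserting [H = H G H] with [G] a pseudo-inverse of [H]. *)
Lemma qform_le_mulmx :
  exists2 K : R, 0 < K & forall z, `|qform z| <= K * enorm (z *m H) ^+ 2.
Proof.
have [K K0 KP] := mulmx_enorm_bounded (pinvmx H).
exists K => // z.
have -> : qform z = dot (z *m H) (z *m H *m pinvmx H).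
  by rewrite [RHS]dotC -dot_mulmx_sym -(mulmxA z H) -(mulmxA z) mulmxKpV.
apply: le_trans (dot_le_enorm _ _) _.
by rewrite expr2 mulrCA ler_wpM2l ?enorm_ge0.
Qed.

Definition cone_form (delta : R) z : R := - qform z - delta * enorm z ^+ 2.

(* For small [delta] the loss [delta * (|Az|^2 - |z|^2)] is absorbed by the
   decrease [c * D ^+ 2] of [qform], because [delta * |z|^2 <= - qform z] is
   itself bounded by a fixed multiple of [D ^+ 2]. *)
Lemma cone_form_expand bs : (forall i, has (fun b => b i) bs) ->
  exists2 delta0 : R, 0 < delta0 & forall delta, 0 < delta <= delta0 ->
  exists2 kappa : R, 0 < kappa & forall z, 0 <= cone_form delta z ->
  cone_form delta z + kappa * enorm z ^+ 2 <= cone_form delta (lin_iter bs z).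
Proof.
move=> bsP.
have [c c0 [C C0 desc]] := lin_iter_descent bs.
have [K K0 KP] := qform_le_mulmx.
pose K1 := K * (n%:R * C) ^+ 2 + 1.
have K10 : 0 < K1 by rewrite ltr_wpDl// mulr_ge0 ?sqr_ge0// ltW.
(* Here [eta * K1 = c / 4], and the bound on [delta] gives [delta * (1 + eta^-1) <= c / 4]: half of
   the decrease [c * D ^+ 2] pays for the growth of [delta * |z|^2], the other half for
   [kappa * |z|^2]. *)
pose eta := c / (4 * K1).
have eta0 : 0 < eta by rewrite divr_gt0// mulr_gt0.
have e1 : 0 < 1 + eta^-1 by rewrite addr_gt0// invr_gt0.
exists (c / 4 / (1 + eta^-1)); first by rewrite !divr_gt0.
move=> delta /andP[d0 dle].
have {}dle : delta * (1 + eta^-1) <= c / 4 by rewrite -ler_pdivlMr.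
exists (c * delta / (2 * K1)); first by rewrite divr_gt0 ?mulr_gt0.
move=> z zc; have [D [D0 Dq Dn DH]] := desc z.
rewrite /cone_form in zc *; set Az := lin_iter bs z in Dq Dn *.
have zH : enorm (z *m H) <= n%:R * C * D.
  by rewrite -mulrA; apply: enorm_le_coord => i; exact: DH.
have zD : delta * enorm z ^+ 2 <= K1 * D ^+ 2.
  have q1 : - qform z <= K * enorm (z *m H) ^+ 2.
    by apply: le_trans (KP z); rewrite -normrN ler_norm.
  have : enorm (z *m H) ^+ 2 <= (n%:R * C) ^+ 2 * D ^+ 2.
    by rewrite -exprMn lerXn2r ?nnegrE ?enorm_ge0 ?mulr_ge0.
  move=> /(ler_wpM2l (ltW K0)); rewrite mulrA => q2.
  have := sqr_ge0 D; rewrite /K1; lra.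
(* Young's inequality with weight [eta] for [(|z| + D)^2]. *)
have Az2 : enorm Az ^+ 2 <= (1 + eta) * enorm z ^+ 2 + (1 + eta^-1) * D ^+ 2.
  have : enorm Az <= enorm z + D.
    by rewrite -[Az](subrK z) addrC; apply: le_trans (enormD_le _ _) _; rewrite lerD2l.
  move=> Az1; apply: (@le_trans _ _ ((enorm z + D) ^+ 2)).
    by rewrite lerXn2r ?nnegrE ?addr_ge0 ?enorm_ge0.
  have : 0 <= eta * (enorm z - eta^-1 * D) ^+ 2 by rewrite mulr_ge0 ?sqr_ge0 ?ltW.
  have -> : eta * (enorm z - eta^-1 * D) ^+ 2 =
    eta * enorm z ^+ 2 - 2 * (eta * eta^-1) * enorm z * D
      + (eta * eta^-1) * (eta^-1 * D ^+ 2) by ring.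
  rewrite divff ?gt_eqF//; lra.
have h1 : delta * enorm Az ^+ 2 <=
    delta * enorm z ^+ 2 + eta * (K1 * D ^+ 2) + c / 4 * D ^+ 2.
  apply: le_trans (ler_wpM2l (ltW d0) Az2) _.
  have := ler_wpM2l (ltW eta0) zD; have := ler_wpM2r (sqr_ge0 D) dle; lra.
have h2 : eta * (K1 * D ^+ 2) = c / 4 * D ^+ 2 by rewrite /eta; field; rewrite gt_eqF.
have h3 : c * delta / (2 * K1) * enorm z ^+ 2 <= c / 2 * D ^+ 2.
  have -> : c * delta / (2 * K1) * enorm z ^+ 2 =
    c / (2 * K1) * (delta * enorm z ^+ 2) by field; rewrite gt_eqF.
  have -> : c / 2 * D ^+ 2 = c / (2 * K1) * (K1 * D ^+ 2) by field; rewrite gt_eqF.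
  by rewrite ler_wpM2l// ltW// divr_gt0// mulr_gt0.
lra.
Qed.

End LinearDescent.

(** * Strict differentiability of the gradient and symmetry of the Hessian *)

Section Calculus.
Variables (R : realType) (n : nat).
Implicit Types (f g : 'rV[R]_n -> R) (x y z d : 'rV[R]_n).

(** The topology on row vectors comes from entrywise balls; this lemma and the next pass to
    Euclidean balls and back. *)
Lemma nbhs_enorm x (P : set 'rV[R]_n) : nbhs x P ->
  exists2 r : R, 0 < r & forall y, enorm (y - x) <= r -> P y.
Proof.
move=> /nbhs_ballP[r /= r0 rP]; exists (r / 2); first by rewrite divr_gt0.
move=> y yr; apply: rP; split => // i j; rewrite (ord1 i) /ball /= distrC.
have := coord_le_enorm (y - x) j; rewrite !mxE => /le_lt_trans; apply.
by apply: le_lt_trans yr _; rewrite ltr_pdivrMr// ltr_pMr// ltr1n.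
Qed.

Lemma enorm_nbhs x (r : R) : 0 < r -> nbhs x [set y | enorm (y - x) <= r].
Proof.
move=> r0; apply/nbhs_ballP; exists (r / n.+1%:R) => /=; first by rewrite divr_gt0.
move=> y yx; apply: (@le_trans _ _ (n%:R * (r / n.+1%:R))).
  apply: enorm_le_coord => i; rewrite !mxE distrC.
  by have [_ /(_ ord0 i)] := yx; rewrite /ball /= => /ltW.
by rewrite mulrCA ler_piMr ?ltW// ltr_pdivrMr// mul1r ltr_nat.
Qed.

Lemma is_derive_line f z d (t : R) : differentiable f (z + t *: d) ->
  is_derive t 1 (fun t => f (z + t *: d)) ('D_d f (z + t *: d)).
Proof.
move=> /(@diff_derivable _ _ _ _ _ d) fd.
have E : (fun h : R => h^-1 *: (((fun t => f (z + t *: d)) \o shift t) (h *: (1:R)) - f (z + t *: d)))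
  = (fun h : R => h^-1 *: ((f \o shift (z + t *: d)) (h *: d) - f (z + t *: d))).
  apply/funext => h /=; congr (_ *: (f _ - _)).
  by rewrite [h *: 1]mulr1 scalerDl addrCA.
by split; rewrite /derivable /derive E.
Qed.

Lemma derive_partial f x d : differentiable f x ->
  'D_d f x = \sum_j d ord0 j * partial f j x.
Proof.
move=> fx; rewrite deriveE// {1}(row_sum_delta d) linear_sum.
by apply: eq_bigr => j _; rewrite linearZ /partial /basis_vec deriveE.
Qed.

Lemma MVT_line f y z : (forall x, differentiable f x) ->
  exists2 c : R, 0 < c < 1 &
  f y - f z = \sum_j (y - z) ord0 j * partial f j (z + c *: (y - z)).
Proof.
move=> fd.
have fl t := is_derive_line (fd (z + t *: (y - z))).
have [|c] := @MVT R _ _ 0 1 ltr01 (fun t _ => fl t).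
  by apply: derivable_within_continuous => t _; have [] := fl t.
rewrite in_itv /= => c01; rewrite scale1r scale0r addr0 subr0 mulr1 [z + (y - z)]addrC subrK => E.
by exists c => //; rewrite E derive_partial.
Qed.

(** Strict differentiability: both points vary near [x], as needed to compare two orbits neither of
    which is [x]. *)
Definition strict_diff_at (g A : 'rV[R]_n -> 'rV[R]_n) x := forall e : R, 0 < e ->
  exists2 r : R, 0 < r & forall y z, enorm (y - x) <= r -> enorm (z - x) <= r ->
  enorm (g y - g z - A (y - z)) <= e * enorm (y - z).

(** The mean value theorem on each component expresses the increment through second partials on the
    segment, which are close to those at [x] by continuity. The transpose appears because symmetry
    of the Hessian is derived from this lemma. *)
Lemma grad_strict_diff f x : C2 f ->
  strict_diff_at (grad f) (fun d => d *m (hessian f x)^T) x.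
Proof.
move=> [_ [fd fc]] e e0; pose e' := e / (n * n).+1%:R.
have e'0 : 0 < e' by rewrite divr_gt0.
have : \forall y \near x, forall i j,
    `|partial (partial f i) j x - partial (partial f i) j y| <= e'.
  apply: (filter_forall (nbhs_filter x)) => i.
  apply: (filter_forall (nbhs_filter x)) => j.
  by have /cvgr_dist_le := fc i j x; apply.
move=> /nbhs_enorm[r r0 rP]; exists r => // y z yr zr.
apply: (@le_trans _ _ (n%:R * (n%:R * (e' * enorm (y - z))))); last first.
  rewrite mulrA -natrM mulrA ler_wpM2r ?enorm_ge0// /e' mulrCA.
  by rewrite ler_piMr ?ltW// ltr_pdivrMr// mul1r ltr_nat.
apply: enorm_le_coord => i.
have -> : (grad f y - grad f z - (y - z) *m (hessian f x)^T) ord0 i =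
    partial f i y - partial f i z - \sum_j (y - z) ord0 j * hessian f x i j.
  rewrite !mxE; congr (_ - _); apply: eq_bigr => j _.
  by rewrite [_^T _ _]mxE.
have [c /andP[c0 c1] ->] := MVT_line y z (fd i).
rewrite -sumrB; apply: le_trans (ler_norm_sum _ _ _) _.
rewrite mulr_natl -[X in _ *+ X]card_ord -sumr_const; apply: ler_sum => j _.
rewrite [hessian _ _ _ _]mxE -mulrBr normrM mulrC.
apply: ler_pM => //; last exact: coord_le_enorm.
rewrite distrC; apply: rP.
(* The intermediate point is a convex combination of [y] and [z], so it stays in the ball. *)
have -> : z + c *: (y - z) - x = (1 - c) *: (z - x) + c *: (y - x).
  by apply/rowP => k; rewrite !mxE; ring.
apply: le_trans (enormD_le _ _) _; rewrite !enormZ !ger0_norm ?subr_ge0 ?(ltW c0) ?(ltW c1)//.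
have -> : r = (1 - c) * r + c * r by ring.
by apply: lerD; apply: ler_wpM2l; rewrite ?subr_ge0 // ltW.
Qed.

Lemma enorm_basis (i : 'I_n) : enorm (basis_vec R i) = 1.
Proof.
rewrite /enorm (bigD1 i)//= big1 => [|j ji]; rewrite !mxE !eqxx /=.
  by rewrite addr0 expr1n sqrtr1.
by rewrite (negbTE ji) expr0n.
Qed.

(** Mean value theorem for the difference of [f] along two parallel segments. *)
Lemma second_difference f x (i j : 'I_n) (h : R) : (forall x, differentiable f x) ->
  exists2 c : R, 0 < c < 1 &
  f (x + h *: basis_vec R i + h *: basis_vec R j) - f (x + h *: basis_vec R j)
    - (f (x + h *: basis_vec R i) - f x) =
  h * (partial f j (x + h *: basis_vec R i + (c * h) *: basis_vec R j)
        - partial f j (x + (c * h) *: basis_vec R j)).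
Proof.
move=> fd; set u := x + h *: _; set v := h *: basis_vec R j.
have D (t : R) : is_derive t 1 (fun t => f (u + t *: v) - f (x + t *: v))
    ('D_v f (u + t *: v) - 'D_v f (x + t *: v)).
  by apply: is_deriveB; apply: is_derive_line.
have [|c] := @MVT R _ _ 0 1 ltr01 (fun t _ => D t).
  by apply: derivable_within_continuous => t _; have [] := D t.
rewrite in_itv /= => c01; rewrite !scale1r !scale0r !addr0 subr0 mulr1 => E.
have Dv y : 'D_v f y = h * partial f j y.
  by rewrite deriveE// /v linearZ /partial deriveE.
by exists c => //; rewrite E !Dv -mulrBr /v !scalerA.
Qed.

(** Schwarz's theorem: the second difference with steps [h] along two axes is symmetric in the axes,
    and divided by [h ^+ 2] it is close to both mixed entries for small [h]. *)
Lemma hessian_sym f x : C2 f -> (hessian f x)^T = hessian f x.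
Proof.
move=> fC; have [fd _] := fC; apply/matrixP => i j; rewrite mxE.
set H := hessian f x.
suff {i j} key (i j : 'I_n) (e : R) : 0 < e -> exists2 r : R, 0 < r & forall h, 0 < h <= r ->
    `|f (x + h *: basis_vec R i + h *: basis_vec R j) - f (x + h *: basis_vec R j)
      - (f (x + h *: basis_vec R i) - f x) - h ^+ 2 * H j i| <= h ^+ 2 * e.
  apply/eqP; rewrite -subr_eq0 -normr_le0; apply/ler_addgt0Pr => e e0; rewrite add0r.
  have e20 : 0 < e / 2 by rewrite divr_gt0.
  have [r1 r10 r1P] := key i j _ e20; have [r2 r20 r2P] := key j i _ e20.
  pose h := Num.min r1 r2; have h0 : 0 < h by rewrite lt_min r10.
  have := r1P h; have := r2P h; rewrite !ge_min !lexx orbT h0 => /(_ isT) h2 /(_ isT).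
  rewrite [x + _ + _]addrAC in h2; move: h2.
  set d := f (_ + _ + _); set d1 := f (_ + _); set d2 := f (_ + _); set d3 := f x => h2 h1.
  have hh : 0 < h ^+ 2 by rewrite exprn_gt0.
  rewrite -(ler_pM2l hh) -[X in X * `|_|]gtr0_norm// -normrM.
  move: h1 h2; rewrite !ler_norml => /andP[a1 a2] /andP[b1 b2].
  by apply/andP; split; lra.
move=> e0; have [r r0 rP] := grad_strict_diff x fC e0.
exists (r / 2); first by rewrite divr_gt0.
move=> h /andP[h0 hr]; have [c /andP[c0 c1] ->] := second_difference x i j h fd.
set y := x + _ + _; set z := x + (c * h) *: _.
have yz : y - z = h *: basis_vec R i.
  by rewrite /y /z opprD addrACA subrr addr0 addrC addKr.
have zr : enorm (z - x) <= r / 2.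
  rewrite /z addrC addKr enormZ enorm_basis mulr1 gtr0_norm ?mulr_gt0//.
  by apply: le_trans hr; rewrite ler_piMl ?ltW.
have yr : enorm (y - x) <= r.
  apply: le_trans (enorm_trans z _ _) _.
  rewrite yz enormZ enorm_basis mulr1 gtr0_norm//; lra.
have zr' : enorm (z - x) <= r by apply: le_trans zr _; lra.
have := le_trans (coord_le_enorm _ j) (rP y z yr zr').
rewrite yz enormZ enorm_basis mulr1 (gtr0_norm h0) -scalemxAl /basis_vec -rowE !mxE.
move=> Hh; rewrite expr2 -!mulrA -mulrBr normrM (gtr0_norm h0) ler_pM2l//.
by rewrite [h * e]mulrC.
Qed.

(** The Lipschitz bound is applied to the gradient increment along [t *: z] for small [t], then
    divided by [t]. *)
Lemma hessian_le f x (L : R) : C2 f -> grad_lipschitz f L ->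
  forall z, enorm (z *m hessian f x) <= L * enorm z.
Proof.
move=> fC fL z; rewrite -{1}(hessian_sym x fC); apply/ler_addgt0Pr => e e0.
have z1 : 0 < enorm z + 1 by rewrite ltr_wpDl ?enorm_ge0.
have [r r0 rP] := grad_strict_diff x fC (divr_gt0 e0 z1).
pose t := r / (enorm z + 1); have t0 : 0 < t by rewrite divr_gt0.
have tz : (x + t *: z) - x = t *: z by rewrite addrC addKr.
have ez : enorm (t *: z) = t * enorm z by rewrite enormZ gtr0_norm.
have := rP (x + t *: z) x; rewrite subrr enorm0 tz (ltW r0) ez => /(_ _ isT).
have -> : t * enorm z <= r by rewrite /t mulrAC ler_pdivrMr// ler_wpM2l ?(ltW r0)// lerDl.
move=> /(_ isT); rewrite -scalemxAl => h1.
have := fL (x + t *: z) x; rewrite tz ez => h2.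
rewrite -(ler_pM2l t0) -{1}(gtr0_norm t0) -enormZ.
set w := t *: (z *m _) in h1 *; set g := grad f _ - grad f x in h1 h2.
have h3 : enorm w <= enorm g + enorm (g - w).
  by rewrite -{1}[w](subKr g); exact: enormB_le.
have h4 : e / (enorm z + 1) * (t * enorm z) <= t * e.
  rewrite mulrCA ler_wpM2l ?(ltW t0)// mulrAC ler_pdivrMr//.
  by rewrite ler_wpM2l ?(ltW e0)// lerDl.
by lra.
Qed.

End Calculus.

(** * Distance estimates for the nonlinear block steps *)

Section BlockSteps.
Variables (R : realType) (n p : nat) (ns : 'I_p -> nat) (f : 'rV[R]_n -> R) (L alpha : R).
Hypothesis (alpha_gt0 : 0 < alpha) (fL : grad_lipschitz f L).
Implicit Types (x y z : 'rV[R]_n) (s : 'I_p) (ss : seq 'I_p).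

Definition block_iter ss x := foldl (fun y s => block_step ns f alpha s y) x ss.

Lemma block_step_mask s x :
  block_step ns f alpha s x = x - alpha *: block_mask (in_block ns s) (grad f x).
Proof. by congr (_ - _ *: _); apply/rowP => i; rewrite !mxE. Qed.

Lemma enorm_mask_le (b : pred 'I_n) z : enorm (block_mask b z) <= enorm z.
Proof.
apply: ler_wsqrtr; apply: ler_sum => i _; rewrite !mxE.
by case: ifP => // _; rewrite expr0n sqr_ge0.
Qed.

Lemma maskB (b : pred 'I_n) y z : block_mask b (y - z) = block_mask b y - block_mask b z.
Proof. by apply/rowP => i; rewrite !mxE; case: ifP => // _; rewrite subr0. Qed.

Lemma block_step_dist s y z :
  block_step ns f alpha s y - block_step ns f alpha s z =
  y - z - alpha *: block_mask (in_block ns s) (grad f y - grad f z).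
Proof. by rewrite !block_step_mask maskB scalerBr !opprB addrACA [RHS]addrACA (addrC (- z)). Qed.

Lemma block_step_grad_le s y z :
  enorm (alpha *: block_mask (in_block ns s) (grad f y - grad f z))
    <= alpha * L * enorm (y - z).
Proof.
rewrite enormZ gtr0_norm// -mulrA ler_pM2l//.
exact: le_trans (enorm_mask_le _ _) (fL _ _).
Qed.

(** Each block step is the identity minus a map with Lipschitz constant [alpha * L], so it shrinks
    distances at most by the factor [1 - alpha * L]. This takes the place of invertibility of the
    sweep. *)
Lemma block_iter_expansive ss y z : alpha * L <= 1 ->
  (1 - alpha * L) ^+ size ss * enorm (y - z)
    <= enorm (block_iter ss y - block_iter ss z).
Proof.
move=> aL; elim: ss y z => [|s ss IH] y z /=; first by rewrite expr0 mul1r.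
apply: le_trans (IH _ _); rewrite exprSr -mulrA ler_wpM2l ?exprn_ge0 ?subr_ge0//.
rewrite block_step_dist; have := block_step_grad_le s y z.
set w := alpha *: _ => h.
have : enorm (y - z) <= enorm (y - z - w) + enorm w.
  by rewrite -{1}[y - z](subrK w) enormD_le.
lra.
Qed.

Lemma block_iter_lipschitz ss : 0 <= alpha * L -> exists2 K : R, 0 <= K &
  forall y z, enorm (block_iter ss y - block_iter ss z) <= K * enorm (y - z).
Proof.
move=> aL; elim: ss => [|s ss [K K0 IH]]; first by exists 1 => // y z; rewrite mul1r.
exists (K * (1 + alpha * L)) => [|y z]; first by rewrite mulr_ge0// addr_ge0.
apply: le_trans (IH _ _) _; rewrite -mulrA ler_wpM2l// block_step_dist.
apply: le_trans (enormB_le _ _) _.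
by rewrite mulrDl mul1r lerD2l block_step_grad_le.
Qed.

Lemma block_iter_critical ss x : critical_point f x -> block_iter ss x = x.
Proof.
move=> fx; elim: ss => //= s ss IH; rewrite block_step_mask fx.
suff -> : block_mask (in_block ns s) 0 = 0 :> 'rV[R]_n by rewrite scaler0 subr0.
by apply/rowP => i; rewrite !mxE if_same.
Qed.

End BlockSteps.

(** * Chain rule for strict derivatives at a fixed point *)

Section StrictDiff.
Variables (R : realType) (n : nat).
Implicit Types (g A : 'rV[R]_n -> 'rV[R]_n) (x y z : 'rV[R]_n).

(** What the chain rule uses of a derivative, stable under composition without a matrix
    representation. *)
Definition bounded_additive A :=
  (forall y z, A (y - z) = A y - A z) /\
  exists2 K : R, 0 < K & forall z, enorm (A z) <= K * enorm z.

Lemma bounded_additive_comp A1 A2 : bounded_additive A1 -> bounded_additive A2 ->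
  bounded_additive (A2 \o A1).
Proof.
move=> [B1 [K1 K10 KP1]] [B2 [K2 K20 KP2]]; split=> [y z|]; first by rewrite /= B1 B2.
exists (K2 * K1) => [|z /=]; first by rewrite mulr_gt0.
by apply: le_trans (KP2 _) _; rewrite -mulrA ler_wpM2l// ltW.
Qed.

Lemma strict_diff_comp g1 g2 A1 A2 x :
  g1 x = x -> bounded_additive A1 -> bounded_additive A2 ->
  strict_diff_at g1 A1 x -> strict_diff_at g2 A2 x ->
  strict_diff_at (g2 \o g1) (A2 \o A1) x.
Proof.
move=> gx [_ [K1 K10 KP1]] [B2 [K2 K20 KP2]] D1 D2 e e0.
(* The bound 1 makes [g1] Lipschitz near [x] with constant [K1 + 1]; the other bound keeps [K2 * e1]
   below [e / 2]. *)
pose e1 := Num.min 1 (e / 2 / K2); pose e2 := e / 2 / (K1 + 1).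
have K110 : 0 < K1 + 1 by rewrite addr_gt0.
have e20 : 0 < e2 by rewrite !divr_gt0.
have e10 : 0 < e1 by rewrite lt_min ltr01 !divr_gt0.
have [r1 r10 r1P] := D1 _ e10; have [r2 r20 r2P] := D2 _ e20.
have lip y z : enorm (y - x) <= r1 -> enorm (z - x) <= r1 ->
    enorm (g1 y - g1 z) <= (K1 + 1) * enorm (y - z).
  move=> yr zr; have := r1P y z yr zr; have := KP1 (y - z).
  have : e1 * enorm (y - z) <= 1 * enorm (y - z).
    by rewrite ler_wpM2r ?enorm_ge0// ge_min lexx.
  have := enormD_le (g1 y - g1 z - A1 (y - z)) (A1 (y - z)); rewrite subrK; lra.
exists (Num.min r1 (r2 / (K1 + 1))); first by rewrite lt_min r10 divr_gt0.
move=> y z; rewrite !le_min !ler_pdivlMr// => /andP[yr1 yr2] /andP[zr1 zr2].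
have xr1 : enorm (x - x) <= r1 by rewrite subrr enorm0 ltW.
have yr : enorm (g1 y - x) <= r2.
  by rewrite -{1}gx; apply: le_trans (lip _ _ yr1 xr1) _; rewrite mulrC.
have zr : enorm (g1 z - x) <= r2.
  by rewrite -{1}gx; apply: le_trans (lip _ _ zr1 xr1) _; rewrite mulrC.
have := r2P _ _ yr zr; have := KP2 (g1 y - g1 z - A1 (y - z)).
have := lip _ _ yr1 zr1; have := r1P _ _ yr1 zr1; rewrite B2 /=.
set a := g2 _ - g2 _; set b := A2 (g1 y - g1 z); set c := A2 (A1 _).
set d := enorm (g1 y - g1 z); set d1 := enorm _; set d0 := enorm (y - z).
move=> h1 h2 h3 h4.
have -> : a - c = (a - b) + (b - c) by rewrite addrA subrK.
apply: le_trans (enormD_le _ _) _.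
have d00 : 0 <= d0 by exact: enorm_ge0.
have h5 : e2 * d <= e / 2 * d0.
  apply: le_trans (ler_wpM2l (ltW e20) h2) _.
  by rewrite mulrA /e2 divfK ?gt_eqF.
have h6 : K2 * d1 <= e / 2 * d0.
  apply: le_trans (ler_wpM2l (ltW K20) h1) _; rewrite mulrA ler_wpM2r//.
  by rewrite mulrC -ler_pdivlMr// ge_min lexx orbT.
lra.
Qed.

End StrictDiff.

(** * Linearization of a sweep at a critical point *)

Section BlockStepsDiff.
Variables (R : realType) (n p : nat) (ns : 'I_p -> nat) (f : 'rV[R]_n -> R) (L alpha : R).
Hypothesis (alpha_gt0 : 0 < alpha) (L_gt0 : 0 < L).
Hypothesis (fC : C2 f) (fL : grad_lipschitz f L).
Variable x : 'rV[R]_n.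
Hypothesis fx : critical_point f x.
Let H := hessian f x.

Lemma lin_step_bounded_additive (b : pred 'I_n) : bounded_additive (lin_step H alpha b).
Proof.
split=> [y z|].
  by rewrite /lin_step mulmxBl maskB scalerBr !opprB addrACA [RHS]addrACA (addrC (- z)).
exists (1 + alpha * L) => [|z]; first by rewrite addr_gt0// mulr_gt0.
apply: le_trans (enormB_le _ _) _; rewrite mulrDl mul1r lerD2l.
rewrite enormZ gtr0_norm// -mulrA ler_pM2l//.
by apply: le_trans (enorm_mask_le _ _) _; exact: hessian_le.
Qed.

Lemma block_step_strict_diff (s : 'I_p) :
  strict_diff_at (block_step ns f alpha s) (lin_step H alpha (in_block ns s)) x.
Proof.
move=> e e0; have [r r0 rP] := grad_strict_diff x fC (divr_gt0 e0 alpha_gt0).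
exists r => // y z yr zr; have := rP y z yr zr; rewrite hessian_sym// -/H => h.
have -> : block_step ns f alpha s y - block_step ns f alpha s z
    - lin_step H alpha (in_block ns s) (y - z) =
    - (alpha *: block_mask (in_block ns s) (grad f y - grad f z - (y - z) *m H)).
  rewrite block_step_dist /lin_step (maskB _ (grad f y - grad f z)) scalerBr.
  by move: (y - z) => d; rewrite !opprB addrC subrKA.
rewrite enormN enormZ gtr0_norm// mulrC -ler_pdivlMr// mulrAC.
exact: le_trans (enorm_mask_le _ _) h.
Qed.

(** A critical point is fixed by every block step, so all factors of the chain rule are derivatives
    at the same point [x]. *)
Lemma block_iter_strict_diff (ss : seq 'I_p) :
  let A := lin_iter H alpha [seq in_block ns s | s <- ss] in
  bounded_additive A /\ strict_diff_at (block_iter ns f alpha ss) A x.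
Proof.
elim: ss => [|s ss [IHA IHD]] /=.
  split; first by split=> //; exists 1 => // z; rewrite mul1r.
  by move=> e e0; exists 1 => // y z _ _; rewrite subrr enorm0 mulr_ge0 ?enorm_ge0 ?ltW.
split; first exact: bounded_additive_comp (lin_step_bounded_additive _) IHA.
apply: (strict_diff_comp _ (lin_step_bounded_additive _) IHA _ IHD).
  exact: (block_iter_critical ns alpha [:: s] fx).
exact: block_step_strict_diff.
Qed.

End BlockStepsDiff.

(** * The expanding cone and orbits that stay close *)

Section Cone.
Variables (R : realType) (n : nat) (H : 'M[R]_n) (L delta : R).
Hypothesis (L_ge0 : 0 <= L) (delta_gt0 : 0 < delta).
Hypothesis (H_sym : H^T = H) (H_le : forall z : 'rV[R]_n, enorm (z *m H) <= L * enorm z).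
Implicit Types (u v x y z : 'rV[R]_n).
Local Notation Q := (cone_form H delta).
Let M := L + delta.

(** [Q] is minus the quadratic form of the symmetric bilinear form [<u, vH> + delta <u, v>], which
    is bounded by [M |u| |v|]. *)
Lemma cone_formD_le u v :
  `|Q (u + v) - Q u| <= M * (2 * enorm u + enorm v) * enorm v.
Proof.
have bnd w w' : `|dot w (w' *m H) + delta * dot w w'| <= M * enorm w * enorm w'.
  apply: le_trans (ler_normD _ _) _; rewrite /M mulrDl mulrDl lerD//.
    apply: le_trans (dot_le_enorm _ _) _.
    by rewrite -mulrA mulrCA ler_wpM2l ?enorm_ge0.
  by rewrite normrM gtr0_norm// -mulrA ler_pM2l// dot_le_enorm.
have -> : Q (u + v) - Q u =
    - (2 * (dot u (v *m H) + delta * dot u v) + (dot v (v *m H) + delta * dot v v)).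
  rewrite /cone_form /qform !enorm_sqr mulmxDl !(dotDl, dotDr).
  rewrite (dotC v u) (dot_mulmx_sym H_sym v u); ring.
rewrite normrN; apply: le_trans (ler_normD _ _) _; rewrite normrM ger0_norm//.
have := bnd u v; have := bnd v v; lra.
Qed.

Lemma cone_form_le u : Q u <= M * enorm u ^+ 2.
Proof.
have Q0 : Q 0 = 0.
  rewrite /cone_form /qform mul0mx enorm0.
  by rewrite -(scale0r 0) dotZl mul0r expr0n mulr0 subr0 oppr0.
have := le_trans (ler_norm _) (cone_formD_le 0 u).
by rewrite add0r Q0 subr0 enorm0 mulr0 add0r -mulrA expr2.
Qed.

Lemma cone_formZ (t : R) u : Q (t *: u) = t ^+ 2 * Q u.
Proof.
rewrite /cone_form /qform !enorm_sqr -scalemxAl !(dotZl, dotZr); ring.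
Qed.

Let M_gt0 : 0 < M. Proof. by rewrite /M ltr_wpDl. Qed.

(** Replacing [A (y - z)] by [g y - g z] changes [Q] by at most a small multiple of [|y - z|^2],
    which consumes half of the gain [kappa]. *)
Lemma cone_form_perturb (g A : 'rV[R]_n -> 'rV[R]_n) x (kappa : R) :
  0 < kappa -> bounded_additive A -> strict_diff_at g A x ->
  (forall z, 0 <= Q z -> Q z + kappa * enorm z ^+ 2 <= Q (A z)) ->
  exists2 r : R, 0 < r & forall y z, enorm (y - x) <= r -> enorm (z - x) <= r ->
    0 <= Q (y - z) -> Q (y - z) + kappa / 2 * enorm (y - z) ^+ 2 <= Q (g y - g z).
Proof.
move=> k0 [_ [K K0 KP]] gA AQ.
have C0 : 0 < M * (2 * K + 1) by rewrite mulr_gt0// addr_gt0// mulr_gt0.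
pose e := Num.min 1 (kappa / 2 / (M * (2 * K + 1))).
have e0 : 0 < e by rewrite lt_min ltr01 !divr_gt0.
have [r r0 rP] := gA e e0; exists r => // y z yr zr Qyz.
have := rP y z yr zr; have := AQ _ Qyz; have := KP (y - z).
set d := y - z; set a := A d; set b := g y - g z - a.
have -> : g y - g z = a + b by rewrite /b [RHS]addrC subrK.
move=> h1 h2 h3; have := cone_formD_le a b; rewrite ler_norml => /andP[h4 _].
have d0 := enorm_ge0 d; have b0 := enorm_ge0 b.
have h5 : M * (2 * enorm a + enorm b) * enorm b <= kappa / 2 * enorm d ^+ 2.
  apply: (@le_trans _ _ (M * ((2 * K + 1) * enorm d) * (e * enorm d))).
    apply: ler_pM => //.
      by rewrite mulr_ge0 ?(ltW M_gt0)// addr_ge0// mulr_ge0 ?enorm_ge0.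
    rewrite ler_pM2l//.
    have : e * enorm d <= 1 * enorm d by rewrite ler_wpM2r// ge_min lexx.
    lra.
  have -> : M * ((2 * K + 1) * enorm d) * (e * enorm d) =
    (e * (M * (2 * K + 1))) * enorm d ^+ 2 by ring.
  by rewrite ler_wpM2r ?sqr_ge0// -ler_pdivlMr// ge_min lexx orbT.
lra.
Qed.

(* Two distinct orbits differing by a vector of the cone separate linearly in
   terms of [Q], so they cannot both stay in a bounded set. *)
Lemma cone_orbits_eq (g : 'rV[R]_n -> 'rV[R]_n) x (r kappa : R) : 0 < kappa ->
  (forall y z, enorm (y - x) <= r -> enorm (z - x) <= r ->
    0 <= Q (y - z) -> Q (y - z) + kappa * enorm (y - z) ^+ 2 <= Q (g y - g z)) ->
  forall y z, (forall k, enorm (iter k g y - x) <= r) ->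
    (forall k, enorm (iter k g z - x) <= r) -> 0 <= Q (y - z) -> y = z.
Proof.
move=> k0 gQ y z yr zr Qyz.
apply/eqP; rewrite -subr_eq0; apply/eqP/enorm0_eq0/eqP/negPn/negP => yz.
have yz0 : 0 < enorm (y - z) by rewrite lt_def yz enorm_ge0.
pose d k := iter k g y - iter k g z.
pose c := kappa * enorm (y - z) ^+ 2.
have c0 : 0 < c by rewrite mulr_gt0// exprn_gt0.
(* Once [Q (d k) >= c], also [|d k|^2 >= c / M], so every later step gains at least
   [kappa * (c / M)]; the first step gains [c]. *)
pose c' := Num.min c (kappa * (c / M)).
have c'0 : 0 < c' by rewrite lt_min c0 mulr_gt0// divr_gt0.
have step k : c <= Q (d k.+1) /\ k.+1%:R * c' <= Q (d k.+1).
  elim: k => [|k [IH1 IH2]].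
    have : c <= Q (d 1%N) by apply: le_trans (gQ _ _ (yr 0%N) (zr 0%N) Qyz); rewrite lerDr.
    by move=> h; split=> //; rewrite mul1r; apply: le_trans h; rewrite ge_min lexx.
  have h := gQ _ _ (yr k.+1) (zr k.+1) (le_trans (ltW c0) IH1).
  have h1 : c / M <= enorm (d k.+1) ^+ 2.
    by rewrite ler_pdivrMr// mulrC; apply: le_trans IH1 (cone_form_le _).
  have h2 : c' <= kappa * enorm (d k.+1) ^+ 2.
    by apply: (@le_trans _ _ (kappa * (c / M))); rewrite ?ge_min ?lexx ?orbT// ler_pM2l.
  split; apply: le_trans h.
    by apply: le_trans IH1 _; rewrite lerDl (le_trans (ltW c'0)).
  by rewrite -natr1 mulrDl mul1r lerD.
(* Two points within [r] of [x] have [Q] of their difference at most [M * (r + r) ^+ 2]; this [k]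
   makes the linear growth exceed it. *)
pose k := Num.truncn (M * (r + r) ^+ 2 / c').
have [_] := step k; apply/negP; rewrite -ltNge.
apply: le_lt_trans (cone_form_le _) _.
apply: (@le_lt_trans _ _ (M * (r + r) ^+ 2)).
  rewrite ler_wpM2l ?(ltW M_gt0)// lerXn2r ?nnegrE ?enorm_ge0//.
    by rewrite addr_ge0// (le_trans (enorm_ge0 _) (yr 0%N)).
  apply: le_trans (enorm_trans x _ _) _.
  by rewrite lerD ?yr// enorm_distC zr.
by rewrite -ltr_pdivrMr// truncnS_gt.
Qed.

(* A set none of whose chords lies in the cone is a Lipschitz graph along any
   direction [w] of the cone. *)
Lemma cone_graph w : 0 < Q w -> exists2 K : R, 0 < K &
  forall d (t : R), (Q d < 0 \/ d = 0) -> enorm d <= K * enorm (d - t *: w).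
Proof.
move=> Qw; pose W := enorm w; have W0 : 0 <= W by exact: enorm_ge0.
(* If [|t| > K |u|], then [t ^+ 2 * Q w] outweighs the error of adding [u] and forces [Q d >= 0].
   The summand 1 ensures [|u| <= |t|]. *)
pose K := M * (2 * W + 1) / Q w + 1.
have K1 : 1 <= K by rewrite lerDr divr_ge0 ?(ltW Qw)// mulr_ge0 ?(ltW M_gt0)// addr_ge0// mulr_ge0.
have K0 : 0 < K by apply: lt_le_trans K1.
exists (1 + K * W); first by rewrite ltr_wpDr ?ltr01// mulr_ge0 ?(ltW K0).
move=> d t [dQ|->]; last first.
  by rewrite enorm0 mulr_ge0 ?enorm_ge0 ?addr_ge0 ?mulr_ge0 ?(ltW K0).
set u := d - t *: w; have u0 := enorm_ge0 u.
have dE : d = t *: w + u by rewrite /u [RHS]addrC subrK.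
suff tu : `|t| <= K * enorm u.
  rewrite [in leLHS]dE; apply: le_trans (enormD_le _ _) _.
  have := ler_wpM2r W0 tu; rewrite enormZ -/W; lra.
rewrite leNgt; apply/negP => tK.
have ut : enorm u <= `|t| by apply: le_trans (ltW tK); rewrite ler_peMl.
have := cone_formD_le (t *: w) u; rewrite -dE cone_formZ ler_norml enormZ -/W => /andP[h _].
have h1 : M * (2 * (`|t| * W) + enorm u) * enorm u <= M * (2 * W + 1) * enorm u * `|t|.
  by have := ler_wpM2l (ltW M_gt0) (ler_wpM2l u0 ut); lra.
have h2 : M * (2 * W + 1) * enorm u <= Q w * `|t|.
  have -> : M * (2 * W + 1) = Q w * (K - 1) by rewrite /K addrK [RHS]mulrC divfK ?gt_eqF.
  rewrite -mulrA ler_pM2l//; lra.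
have h3 := ler_wpM2r (normr_ge0 t) h2.
have tt : `|t| * `|t| = t ^+ 2 by rewrite -expr2 real_normK ?num_real.
rewrite -[Q w * _ * _]mulrA tt in h3.
lra.
Qed.

End Cone.

(** * Null sets through coverings by small cubes *)

Section Covering.
Variable R : realType.

(** One cube per key suffices: [N.+1 ^ m] cubes of side [2 C / N.+1] in dimension [m.+1] have total
    volume [(2 C)^(m+1) / N.+1]. *)
Lemma lebesgue_null_keys (m : nat) (A : set 'rV[R]_m.+1) (C : R) : 0 < C ->
  (forall N : nat, exists key : 'rV[R]_m.+1 -> {ffun 'I_m -> 'I_N.+1},
    forall x y, A x -> A y -> key x = key y ->
    forall i, `|x ord0 i - y ord0 i| <= C / N.+1%:R) ->
  lebesgue_null A.
Proof.
move=> C0 keyP e e0.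
pose N := Num.truncn ((2 * C) ^+ m.+1 / e).
have NP : (2 * C) ^+ m.+1 / N.+1%:R <= e.
  rewrite ler_pdivrMr// [e * _]mulrC -ler_pdivrMr//; apply/ltW; exact: truncnS_gt.
have [key {}keyP] := keyP N.
pose h : R := C / N.+1%:R; have h0 : 0 < h by rewrite divr_gt0.
pose F := {ffun 'I_m -> 'I_N.+1}.
have cardF : #|{: F}| = (N.+1 ^ m)%N by rewrite card_ffun !card_ord.
pose rep (k : F) : 'rV[R]_m.+1 := xget 0 [set x | A x /\ key x = k].
pose center (j : nat) := rep (nth [ffun=> ord0] (enum F) j).
(* Beyond the last key the boxes degenerate to points, of volume 0 because the dimension is
   positive. *)
pose rad (j : nat) : R := if (j < #|F|)%N then h else 0.
have rad0 j : 0 <= rad j by rewrite /rad; case: ifP => // _; exact: ltW.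
exists (fun j => center j - const_mx (rad j)), (fun j => center j + const_mx (rad j)).
split; [|split].
- move=> j i; rewrite !mxE; have := rad0 j; lra.
- move=> x Ax; exists (enum_rank (key x)) => //= i; rewrite !mxE.
  have -> : rad (enum_rank (key x)) = h by rewrite /rad ltn_ord.
  rewrite /center nth_enum_rank.
  have [Ar kr] : A (rep (key x)) /\ key (rep (key x)) = key x.
    by apply: (@xgetPex _ 0 [set y | A y /\ key y = key x]); exists x.
  have := keyP _ _ Ar Ax kr i; rewrite -/h ler_norml => /andP[? ?].
  by apply/andP; split; lra.
- have vol j : box_vol (center j - const_mx (rad j)) (center j + const_mx (rad j))
      = (2 * rad j) ^+ m.+1.
    rewrite /box_vol (eq_bigr (fun=> 2 * rad j)); first by rewrite prodr_const card_ord.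
    by move=> i _; rewrite !mxE; ring.
  apply: lime_le.
    apply: is_cvg_nneseries => j _ _; rewrite vol lee_fin.
    by rewrite exprn_ge0// mulr_ge0.
  apply: nearW => q; rewrite sumEFin lee_fin (eq_bigr _ (fun j _ => vol j)).
  apply: le_trans NP.
  have -> : (2 * C) ^+ m.+1 / N.+1%:R = #|F|%:R * (2 * h) ^+ m.+1.
    rewrite cardF /h natrX mulrA expr_div_n [N.+1%:R ^+ m.+1]exprS.
    have N0 : N.+1%:R != 0 :> R by rewrite pnatr_eq0.
    by rewrite invfM mulrCA [N.+1%:R^-1 * _]mulrC mulVKf// expf_neq0.
  have hm : 0 <= (2 * h) ^+ m.+1 by rewrite exprn_ge0// mulr_ge0// ltW.
  apply: (@le_trans _ _ ((minn q #|F|)%:R * (2 * h) ^+ m.+1)); last first.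
    by rewrite ler_wpM2r// ler_nat geq_minr.
  elim: q => [|q IH]; first by rewrite big_geq// min0n mul0r.
  rewrite big_nat_recr//= /rad; case: ifP => qF.
    rewrite (minn_idPl qF) -[q.+1%:R]natr1 [(q%:R + 1) * _]mulrDl mul1r lerD2r.
    by move: IH; rewrite (minn_idPl (ltnW qF)).
  rewrite mulr0 expr0n addr0; apply: le_trans IH _.
  by rewrite ler_wpM2r// ler_nat leq_min geq_minr andbT (leq_trans (geq_minl _ _)).
Qed.

(** The second bound says that the projection of [g x] along [w] determines [x] in a Lipschitz way;
    the key of [x] is the grid cell of this projection. *)
Lemma lebesgue_null_graph (n : nat) (A : set 'rV[R]_n)
    (g : 'rV[R]_n -> 'rV[R]_n) (x0 w : 'rV[R]_n) (i0 : 'I_n) (r K : R) :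
  w ord0 i0 = 1 -> 0 < K ->
  (forall x, A x -> enorm (g x - x0) <= r) ->
  (forall x y (t : R), A x -> A y -> enorm (x - y) <= K * enorm (g x - g y - t *: w)) ->
  lebesgue_null A.
Proof.
case: n A g x0 w i0 => [|m] A g x0 w i0; first by case: i0.
move=> w1 K0 Ar AK.
pose pr x := g x - x0 - (g x - x0) ord0 i0 *: w.
pose b := `|r| * (1 + enorm w) + 1.
have b0 : 0 < b by rewrite ltr_wpDl// mulr_ge0// addr_ge0 ?enorm_ge0.
have prb x i : A x -> `|pr x ord0 i| < b.
  move=> Ax; apply: le_lt_trans (coord_le_enorm _ _) _.
  apply: le_lt_trans (enormB_le _ _) _; rewrite enormZ.
  have h1 : enorm (g x - x0) <= `|r| by apply: le_trans (Ar _ Ax) (ler_norm _).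
  have h2 := le_trans (coord_le_enorm (g x - x0) i0) h1.
  have := ler_wpM2r (enorm_ge0 w) h2; rewrite /b; lra.
apply: (@lebesgue_null_keys _ _ (K * (m.+1%:R * (2 * b)))); first by rewrite !mulr_gt0.
(* Rescales the range from [-b] to [b] to that from 0 to [N.+1], so that truncation yields the cell
   index. *)
move=> N; pose s x i := (pr x ord0 i + b) / (2 * b) * N.+1%:R.
have s0 x i : A x -> 0 <= s x i.
  move=> /(@prb _ i); rewrite ltr_norml => /andP[h _].
  by rewrite mulr_ge0// divr_ge0 ?mulr_ge0 ?(ltW b0)//; lra.
have sN x i : A x -> s x i < N.+1%:R.
  move=> /(@prb _ i); rewrite ltr_norml => /andP[_ h].
  by rewrite gtr_pMl// ltr_pdivrMr ?mulr_gt0//; lra.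
exists (fun x => [ffun j => inord (Num.truncn (s x (lift i0 j)))]) => x y Ax Ay kxy i.
have prxy j : `|(pr x - pr y) ord0 j| <= 2 * b / N.+1%:R.
  (* Coordinate [i0] of [pr] vanishes as [w ord0 i0 = 1], so [m] coordinates make up the key. *)
  have [->|[j' ->]] : j = i0 \/ exists j', j = lift i0 j'.
    by case: (unliftP i0 j) => [j' jE|jE]; [right; exists j'|left].
    by rewrite !mxE w1 !mulr1 !subrr normr0 divr_ge0// mulr_ge0// (ltW b0).
  have := congr1 (fun k : {ffun _} => nat_of_ord (k j')) kxy; rewrite !ffunE !inordK.
  - move=> E; have /andP[] := truncn_itv (s0 x (lift i0 j') Ax).
    have /andP[] := truncn_itv (s0 y (lift i0 j') Ay); rewrite E => a1 a2 a3 a4.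
    have : `|s x (lift i0 j') - s y (lift i0 j')| <= 1.
      by rewrite ler_norml -natr1 in a2 a4 *; apply/andP; split; lra.
    have -> : s x (lift i0 j') - s y (lift i0 j') =
        (pr x - pr y) ord0 (lift i0 j') * (N.+1%:R / (2 * b)).
      have -> : (pr x - pr y) ord0 (lift i0 j') = pr x ord0 (lift i0 j') - pr y ord0 (lift i0 j').
        by rewrite !mxE.
      by rewrite /s; ring.
    by rewrite normrM [`|_ / _|]gtr0_norm ?divr_gt0 ?mulr_gt0// mulrA ler_pdivrMr ?mulr_gt0// mul1r ler_pdivlMr.
  - by rewrite ltnS truncn_le_nat sN.
  - by rewrite ltnS truncn_le_nat sN.
have := coord_le_enorm (x - y) i; rewrite [(x - y) _ _]mxE [X in `|_ + X|]mxE => /le_trans; apply.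
have t : {t | pr x - pr y = g x - g y - t *: w}.
  exists ((g x - x0) ord0 i0 - (g y - x0) ord0 i0).
  by apply/rowP => j; rewrite !mxE; ring.
case: t => t E; apply: le_trans (AK x y t Ax Ay) _.
rewrite -E -!mulrA ler_pM2l//.
by apply: enorm_le_coord => j; rewrite mulrA.
Qed.

End Covering.

(** The block of [i] is the predecessor of the least [k] whose first [k] blocks reach past [i]. *)
Lemma in_block_cover (n p : nat) (ns : 'I_p -> nat) (i : 'I_n) :
  (\sum_(s < p) ns s)%N = n -> exists s, in_block ns s i.
Proof.
move=> nsn; pose S k := (\sum_(t < p | (t < k)%N) ns t)%N.
have Sp k : (p <= k)%N -> S k = n.
  move=> pk; rewrite -nsn; apply: eq_bigl => t.
  by rewrite (leq_trans (ltn_ord t) pk).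
have ex : exists k, (i < S k)%N by exists p; rewrite Sp.
case: (ex_minnP ex) => -[|k] ik kmin.
  by move: ik; rewrite /S big_pred0.
have kp : (k < p)%N.
  rewrite ltnNge; apply/negP => pk.
  by have := kmin k; rewrite Sp// ltn_ord ltnn => /(_ isT).
exists (Ordinal kp); apply/andP; split => //=.
by rewrite leqNgt; apply/negP => /kmin; rewrite ltnn.
Qed.

(** * Orbits remaining near the saddle, and convergence *)

Section Stay.
Variables (R : realType) (n p : nat) (ns : 'I_p -> nat).
Hypothesis ns_sum : (\sum_(s < p) ns s)%N = n.
Variables (f : 'rV[R]_n -> R) (L alpha : R) (xs : 'rV[R]_n).
Hypothesis (L_gt0 : 0 < L) (fC : C2 f) (fL : grad_lipschitz f L).
Hypothesis (alphaP : 0 < alpha < L^-1).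
Local Notation T := (bcgd_step ns f alpha).

Definition stay (r : R) (N : nat) : set 'rV[R]_n :=
  [set x | forall k, enorm (iter k T (iter N T x) - xs) <= r].

Let alpha_gt0 : 0 < alpha. Proof. by case/andP: alphaP. Qed.
Let alphaL : alpha * L < 1.
Proof. by case/andP: alphaP => _; rewrite -[L^-1]div1r ltr_pdivlMr. Qed.

Lemma iter_bcgd_expansive : exists2 c : R, 0 < c &
  forall N y z, c ^+ N * enorm (y - z) <= enorm (iter N T y - iter N T z).
Proof.
exists ((1 - alpha * L) ^+ size (enum 'I_p)); first by rewrite exprn_gt0// subr_gt0.
elim=> [|N IH] y z; first by rewrite mul1r.
apply: le_trans (block_iter_expansive ns alpha_gt0 fL _ _ _ (ltW alphaL)).
by rewrite exprS -mulrA ler_wpM2l// exprn_ge0// subr_ge0 ltW.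
Qed.

(** Closedness gives Borel measurability, which [leb_abs_cont] requires of a null set. *)
Lemma closed_stay r N : closed (stay r N).
Proof.
have lip k : exists2 K : R, 0 <= K &
    forall y z, enorm (iter k T y - iter k T z) <= K * enorm (y - z).
  have [|K K0 KP] := block_iter_lipschitz ns alpha_gt0 fL (enum 'I_p).
    by rewrite mulr_ge0 ?ltW.
  elim: k => [|k [K' K'0 IH]]; first by exists 1 => // y z; rewrite mul1r.
  exists (K * K') => [|y z]; first by rewrite mulr_ge0.
  by apply: (le_trans (KP (iter k T y) (iter k T z))); rewrite -mulrA ler_wpM2l.
have -> : stay r N = \bigcap_k [set x | enorm (iter (k + N) T x - xs) <= r].
  apply/seteqP; split => x /= h; first by move=> k _ /=; rewrite iterD; exact: h.
  by move=> k; rewrite -iterD; exact: h.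
apply: closed_bigI => k _; have [K K0 KP] := lip (k + N)%N.
rewrite -openC openE => x /= /negP; rewrite -ltNge => xr.
pose e := (enorm (iter (k + N) T x - xs) - r) / 2 / (K + 1).
have K10 : 0 < K + 1 by rewrite ltr_wpDl.
have e0 : 0 < e by rewrite !divr_gt0// subr_gt0.
apply: filterS (enorm_nbhs x e0) => y /= ye; apply/negP; rewrite -ltNge.
have h1 : enorm (iter (k + N) T y - iter (k + N) T x) <=
    (enorm (iter (k + N) T x - xs) - r) / 2.
  apply: le_trans (KP _ _) _; apply: (@le_trans _ _ ((K + 1) * e)).
    by apply: ler_pM; rewrite ?enorm_ge0// lerDl.
  by rewrite /e mulrC divfK ?gt_eqF.
have := enorm_trans (iter (k + N) T y) (iter (k + N) T x) xs.
rewrite (enorm_distC _ (iter (k + N) T y)); lra.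
Qed.

Lemma stay_null : strict_saddle f xs ->
  exists2 r : R, 0 < r & forall N, lebesgue_null (stay r N).
Proof.
move=> [fx [a [/eigenvalueP[v vH v0] a0]]].
pose H := hessian f xs.
have H_sym : H^T = H by exact: hessian_sym.
have H_le : forall z, enorm (z *m H) <= L * enorm z by exact: hessian_le.
pose bs : seq (pred 'I_n) := [seq in_block ns s | s <- enum 'I_p].
have bsP i : has (fun b : pred 'I_n => b i) bs.
  have [s si] := in_block_cover i ns_sum.
  by rewrite /bs has_map; apply/hasP; exists s => //=; rewrite mem_enum.
have [d0 d00 d0P] := cone_form_expand (ltW L_gt0) alpha_gt0 (ltW alphaL) H_sym H_le bsP.
(* Keeping [delta] below [- a] puts the eigenvector inside the cone: its [Q] equals
   [(- a - delta) |v|^2]. *)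
pose delta := Num.min d0 (- a / 2).
have delta_gt0 : 0 < delta by rewrite lt_min d00 divr_gt0// oppr_gt0.
have [|kappa k0 kP] := d0P delta; first by rewrite delta_gt0 ge_min lexx.
have [A_add A_diff] := block_iter_strict_diff ns alpha_gt0 L_gt0 fC fL fx (enum 'I_p).
have [r r0 rP] := cone_form_perturb (ltW L_gt0) delta_gt0 H_sym H_le k0 A_add A_diff kP.
have orb := cone_orbits_eq (ltW L_gt0) delta_gt0 H_sym H_le (divr_gt0 k0 (ltr0n R 2)) rP.
exists r => // N.
have [i0 vi0] : exists i, v ord0 i != 0.
  apply/existsP; apply: contraNT v0 => /existsPn vi.
  by apply/eqP/rowP => i; rewrite mxE; apply/eqP; rewrite -[_ == _]negbK.
have vn : 0 < enorm v by apply: lt_le_trans (coord_le_enorm v i0); rewrite normr_gt0.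
pose w := (v ord0 i0)^-1 *: v.
have Qw : 0 < cone_form H delta w.
  rewrite cone_formZ mulr_gt0// ?exprn_even_gt0 ?invr_eq0 ?vi0 ?orbT//.
  rewrite /cone_form /qform vH dotZr -enorm_sqr -mulNr -mulrBl mulr_gt0 ?exprn_gt0//.
  have : delta <= - a / 2 by rewrite ge_min lexx orbT.
  move: a0; lra.
have [K K0 KP] := cone_graph (ltW L_gt0) delta_gt0 H_sym H_le Qw.
have [c c0 cP] := iter_bcgd_expansive.
have cN : 0 < c ^+ N by rewrite exprn_gt0.
apply: (@lebesgue_null_graph _ _ _ (iter N T) xs w i0 r (K / c ^+ N)).
- by rewrite mxE mulVf.
- by rewrite divr_gt0.
- by move=> x /(_ 0%N).
- move=> x y t sx sy.
  rewrite -mulrAC ler_pdivlMr// mulrC; apply: le_trans (cP N x y) _; apply: KP.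
  (* Either the chord of the images lies outside the cone, or the two images coincide by [orb]. *)
  have [|Qd] := ltP (cone_form H delta (iter N T x - iter N T y)) 0; first by left.
  by right; rewrite (orb _ _ sx sy Qd) subrr.
Qed.

(** Radii [1 / (m + 1)] suffice for convergence, so the event is built from closed sets by countable
    operations. *)
Lemma cvg_bcgd_stay : [set x | bcgd_seq ns f alpha x @ \oo --> xs] =
  \bigcap_m \bigcup_N stay m.+1%:R^-1 N.
Proof.
apply/seteqP; split => [x /= xc m _|x /= xs_].
  have m0 : 0 < m.+1%:R^-1 :> R by rewrite invr_gt0.
  have [N _ NP] := xc _ (enorm_nbhs xs m0).
  by exists N => // k; rewrite -iterD; apply: NP => /=; rewrite leq_addl.
move=> P /nbhs_enorm[r r0 rP].
have [N _ NP] := xs_ (Num.truncn r^-1) I.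
exists N => //= k Nk; apply: rP; rewrite /bcgd_seq -(subnK Nk) iterD.
apply: le_trans (NP _) _.
by rewrite -[leRHS]invrK lef_pV2 ?posrE ?invr_gt0// ltW// truncnS_gt.
Qed.

End Stay.

(** * Measurability and the probability statement *)

Lemma closed_measurable (R : realType) (n : nat) (A : set 'rV[R]_n) :
  closed A -> measurable (A : set (borel_rV R n)).
Proof.
move=> Acl; rewrite -[A]setCK; apply: measurableC.
by apply: sub_sigma_algebra; exact: closed_openC.
Qed.

Theorem theorem2 (R : realType) (n p : nat) (ns : 'I_p -> nat)
  (Hns_pos : forall s, (0 < ns s)%N) (Hns_sum : (\sum_(s < p) ns s)%N = n)
  (f : 'rV[R]_n -> R) (L : R) (HL : 0 < L)
  (Hf : C2 f) (Hlip : grad_lipschitz f L)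
  (xs : 'rV[R]_n) (Hsaddle : strict_saddle f xs)
  (alpha : R) (Halpha : 0 < alpha < L^-1)
  (nu : probability (borel_rV R n) R) (Hnu : leb_abs_cont nu) :
  nu [set x0 : borel_rV R n | bcgd_seq ns f alpha x0 @ \oo --> xs] = 0%E.
Proof.
have stay_meas r N : measurable (stay ns f alpha xs r N : set (borel_rV R n)).
  by apply: closed_measurable; exact: (closed_stay HL Hlip Halpha).
have [r r0 rP] := stay_null Hns_sum HL Hf Hlip Halpha Hsaddle.
rewrite cvg_bcgd_stay; apply: measure_negligible.
  by apply: bigcapT_measurable => m; exact: bigcupT_measurable.
(* Convergent orbits eventually stay within the single radius [r], so one countable union of null
   sets covers the event. *)
apply: (@negligibleS _ (borel_rV R n) _ _ (\bigcup_N stay ns f alpha xs r N)).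
  move=> x /(_ (Num.truncn r^-1) I)[N _ NP]; exists N => // k.
  apply: le_trans (NP k) _.
  by rewrite -[leRHS]invrK lef_pV2 ?posrE ?invr_gt0// ltW// truncnS_gt.
apply: negligible_bigcup => N; apply/negligibleP; first exact: stay_meas.
by apply: Hnu; [exact: stay_meas|exact: rP].
Qed.
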